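(* For any $\lambda,\nu\in\mathbb C$ such that $a:=\nu-\lambda\in\mathbb N$ we have $$\iota\circ\big(\mathbb D^1_{\lambda,\nu}-\mathbb D^{-1}_{\lambda,\nu}\big)\circ A^{-1}=K\,\widetilde{\mathbb C}^{1,1}_{\lambda,\nu},$$ where $K\equiv K(\lambda,\nu)=1$ if $a=0$ and $K=2$ if $a\ge1$. (Both sides are operators from smooth complex 1-forms on $\mathbb R^3$ to smooth complex 1-forms on $\mathbb R^2=\{x_3=0\}$.)
   Context: $\mathbb N=\{0,1,\dots\}$; $[x]$ integer part. Coordinates $(x_1,x_2,x_3)$ on $\mathbb R^3$, $\mathbb R^2=\{x_3=0\}$, $z=x_1+ix_2$, so $2\partial_{\bar z}=\partial_{x_1}+i\partial_{x_2}$, $2\partial_z=\partial_{x_1}-i\partial_{x_2}$. $\mathrm{Rest}_{x_3=0}$ is restriction to $x_3=0$ (pull-back for differential forms). Scalar operators. $\widetilde C^\mu_\ell(z)=\frac1{\Gamma(\mu+[\frac{\ell+1}2])}\sum_{k=0}^{[\ell/2]}(-1)^k\frac{\Gamma(\mu+\ell-k)}{k!(\ell-2k)!}(2z)^{\ell-2k}$ (Gamma quotients being polynomials in $\mu$), $\widetilde C^\mu_d=0$ for $d<0$; $(I_\ell\widetilde C^\mu_\ell)(x,y)=x^{\ell/2}\widetilde C^\mu_\ell(y/\sqrt x)$. For $\nu-\lambda\in\mathbb N$, $\widetilde{\mathbb C}_{\lambda,\nu}=\mathrm{Rest}_{x_3=0}\circ(I_{\nu-\lambda}\widetilde C^{\lambda-1}_{\nu-\lambda})(-\partial_{x_1}^2-\partial_{x_2}^2,\partial_{x_3})$,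 and $\widetilde{\mathbb C}_{\lambda,\nu}=0$ if $\nu-\lambda$ is a negative integer. On 1-forms these act on coefficients, followed by pull-back to $x_3=0$. $\gamma(\mu,\ell)=1$ for $\ell$ odd, $\mu+\frac\ell2$ for $\ell$ even. Operators $\mathbb D^{\pm1}_{\lambda,\nu}:C^\infty(\mathbb R^3,V^3)\to C^\infty(\mathbb R^2)$, where $V^3\simeq\mathbb C^3$ has basis $u_1,u_2,u_3$ with dual basis $u_s^\vee$ and $D\otimes u_s^\vee$ sends $F$ to $D\langle u_s^\vee,F\rangle$. For $a=0$: $\mathbb D^1_{\lambda,\lambda}=\mathrm{Rest}_{x_3=0}\otimes u_1^\vee$, $\mathbb D^{-1}_{\lambda,\lambda}=\mathrm{Rest}_{x_3=0}\otimes u_3^\vee$. For $a\ge1$: $$\mathbb D^1_{\lambda,\nu}=\Big(\lambda+\Big[\tfrac{a-1}2\Big]\Big)\widetilde{\mathbb C}_{\lambda+1,\nu+1}\otimes u_1^\vee+2\gamma(\lambda-1,a)\widetilde{\mathbb C}_{\lambda+1,\nu}\partial_{\bar z}\otimes u_2^\vee+4\widetilde{\mathbb C}_{\lambda+1,\nu-1}\partial_{\bar z}^2\otimes u_3^\vee,$$ $$\mathbb D^{-1}_{\lambda,\nu}=4\widetilde{\mathbb C}_{\lambda+1,\nu-1}\partial_z^2\otimes u_1^\vee-2\gamma(\lambda-1,a)\widetilde{\mathbb C}_{\lambda+1,\nu}\partial_z\otimes u_2^\vee+\Big(\lambda+\Big[\tfrac{a-1}2\Big]\Big)\widetilde{\mathbb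 C}_{\lambda+1,\nu+1}\otimes u_3^\vee.$$ Identifications. $A:V^3\to\mathbb C^3$ is the isomorphism with matrix $\begin{pmatrix}1&0&-1\\-i&0&-i\\0&-1&0\end{pmatrix}$, so $A^{-1}(f_1dx_1+f_2dx_2+f_3dx_3)=\frac12(f_1+if_2)u_1-f_3u_2+\frac12(-f_1+if_2)u_3$. The target of $\mathbb D^{\pm1}$ is viewed as the summand labelled $\pm1$ of $C^\infty(\mathbb R^2,\mathbb C_{-1})\oplus C^\infty(\mathbb R^2,\mathbb C_1)$ (so $\mathbb D^1-\mathbb D^{-1}$ has components $\psi_{1}=\mathbb D^1F$, $\psi_{-1}=-\mathbb D^{-1}F$), and $\iota(\psi_{-1}+\psi_1)=\psi_{-1}(dx_1+i\,dx_2)+\psi_1(dx_1-i\,dx_2)$. Kobayashi–Kubo–Pevzner operator. $\widetilde{\mathbb C}^{1,1}_{\lambda,\nu}=\mathrm{Rest}_{x_3=0}$ if $a=0$; if $a\ge1$, $$\widetilde{\mathbb C}^{1,1}_{\lambda,\nu}=\widetilde{\mathbb C}_{\lambda+1,\nu-1}d_{\mathbb R^3}d^*_{\mathbb R^3}-\gamma(\lambda-\tfrac32,a)\widetilde{\mathbb C}_{\lambda,\nu-1}d_{\mathbb R^3}\iota_{\partial/\partial x_3}+\tfrac{\lambda+a-1}2\widetilde{\mathbb C}_{\lambda,\nu},$$ with $d_{\mathbb R^3}$ the exterior derivative, $d^*_{\mathbb R^3}$ the codifferential ($d^*(\sum f_jdx_j)=-\sum\partial_{x_j}f_j$), $\iota_{\partial/\partial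 x_3}$ interior multiplication. *)

(* Defs.v *)
From HB Require Import structures.
From mathcomp Require Import all_boot all_order all_algebra.
From mathcomp Require Import complex.
From mathcomp Require Import all_classical all_reals all_analysis.
From mathcomp Require Import ring.

Set Implicit Arguments.
Unset Strict Implicit.
Unset Printing Implicit Defensive.

Import Order.TTheory GRing.Theory Num.Theory.
Import numFieldNormedType.Exports.

Local Open Scope classical_set_scope.
Local Open Scope ring_scope.
Local Open Scope complex_scope.

Section SmoothFunctions.
Context {R : realType}.
Local Notation C := R[i].

Definition cRe {T : Type} (f : T -> C) (x : T) : R := complex.Re (f x).
Definition cIm {T : Type} (f : T -> C) (x : T) : R := complex.Im (f x).

Section Dim.
Context {n : nat}.
Implicit Types (f g : 'rV[R]_n -> C) (j : 'I_n) (s : seq 'I_n).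

Definition ebase j : 'rV[R]_n := delta_mx 0 j.

(* R[i] carries no normed R-module structure in the library, hence the
   componentwise derivative. *)
Definition pderiv j f (x : 'rV[R]_n) : C :=
  ('D_(ebase j) (cRe f) x) +i* ('D_(ebase j) (cIm f) x).

Definition iterpd s f := foldr pderiv f s.

Definition pderivable f := forall j x,
  derivable (cRe f) x (ebase j) /\ derivable (cIm f) x (ebase j).

Definition is_smooth f := forall s,
  [/\ continuous (cRe (iterpd s f)), continuous (cIm (iterpd s f)) &
      pderivable (iterpd s f)].

Lemma cRe_lin (c : C) f g : cRe (c *: f + g) =
  (complex.Re c \*: cRe f) - (complex.Im c \*: cIm f) + cRe g.
Proof.
apply/funext => x.
change (complex.Re (c * f x + g x) =
  complex.Re c * complex.Re (f x) - complex.Im c * complex.Im (f x)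
  + complex.Re (g x)).
by case: c (f x) (g x) => [a b] [u v] [p q].
Qed.

Lemma cIm_lin (c : C) f g : cIm (c *: f + g) =
  (complex.Re c \*: cIm f) + (complex.Im c \*: cRe f) + cIm g.
Proof.
apply/funext => x.
change (complex.Im (c * f x + g x) =
  complex.Re c * complex.Im (f x) + complex.Im c * complex.Re (f x)
  + complex.Im (g x)).
by case: c (f x) (g x) => [a b] [u v] [p q].
Qed.

Lemma pderivable_lin (c : C) f g :
  pderivable f -> pderivable g -> pderivable (c *: f + g).
Proof.
move=> df dg j x; have [fr fi] := df j x; have [gr gi] := dg j x.
rewrite cRe_lin cIm_lin; split; apply: derivableD => //.
  by apply: derivableB; exact: derivableZ.
by apply: derivableD; exact: derivableZ.
Qed.

Lemma pderiv_lin (c : C) f g j : pderivable f -> pderivable g ->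
  pderiv j (c *: f + g) = c *: pderiv j f + pderiv j g.
Proof.
move=> df dg; apply/funext => x; rewrite fctE /pderiv cRe_lin cIm_lin.
have [fr fi] := df j x; have [gr gi] := dg j x.
have Z k (h : 'rV[R]_n -> R) : derivable h x (ebase j) ->
  derivable (k \*: h) x (ebase j) by exact: derivableZ.
have E k (h : 'rV[R]_n -> R) : derivable h x (ebase j) ->
  'D_(ebase j) (k \*: h) x = k * 'D_(ebase j) h x by exact: deriveZ.
have r1 := Z (complex.Re c) _ fr; have r2 := Z (complex.Im c) _ fi.
have i1 := Z (complex.Re c) _ fi; have i2 := Z (complex.Im c) _ fr.
rewrite (deriveD (derivableB r1 r2) gr) (deriveB r1 r2).
rewrite (deriveD (derivableD i1 i2) gi) (deriveD i1 i2).
rewrite (E _ _ fr) (E _ _ fi) (E _ _ fr) (E _ _ fi).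
by rewrite /GRing.scale /=; case: (c).
Qed.

Lemma iterpd_lin (c : C) f g s : is_smooth f -> is_smooth g ->
  iterpd s (c *: f + g) = c *: iterpd s f + iterpd s g.
Proof.
move=> sf sg; elim: s => //= j s ->; apply: pderiv_lin.
  by have [] := sf s.
by have [] := sg s.
Qed.

Lemma is_smooth_lin (c : C) f g :
  is_smooth f -> is_smooth g -> is_smooth (c *: f + g).
Proof.
move=> sf sg s; rewrite iterpd_lin //.
have [fr fi fd] := sf s; have [gr gi gd] := sg s.
split; last exact: pderivable_lin.
  rewrite cRe_lin => x; apply: cvgD (gr x).
  by apply: cvgB; apply: cvgZl_tmp; [exact: fr|exact: fi].
rewrite cIm_lin => x; apply: cvgD (gi x).
by apply: cvgD; apply: cvgZl_tmp; [exact: fi|exact: fr].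
Qed.

Lemma is_smooth0 : is_smooth 0.
Proof.
have r0 : cRe (0 : 'rV[R]_n -> C) = cst 0 by apply/funext.
have i0 : cIm (0 : 'rV[R]_n -> C) = cst 0 by apply/funext.
have d0 j : pderiv j 0 = 0.
  by apply/funext => x; rewrite /pderiv r0 i0 derive_cst.
have E s : iterpd s 0 = 0 by elim: s => //= j s ->.
move=> s; rewrite E /pderivable r0 i0; split; try exact: cst_continuous.
by move=> j x; split; exact: derivable_cst.
Qed.

Lemma is_smooth_pderiv j f : is_smooth f -> is_smooth (pderiv j f).
Proof.
by move=> sf s; have := sf (rcons s j); rewrite /iterpd foldr_rcons.
Qed.

Definition smooth : {pred 'rV[R]_n -> C} := fun f => `[< is_smooth f >].

Lemma smoothP f : reflect (is_smooth f) (f \in smooth).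
Proof. exact: asboolP. Qed.

Fact smooth_submod_closed : submod_closed smooth.
Proof.
split; first exact/smoothP/is_smooth0.
by move=> c f g /smoothP sf /smoothP sg; apply/smoothP/is_smooth_lin.
Qed.
HB.instance Definition _ :=
  GRing.isSubmodClosed.Build C ('rV[R]_n -> C) smooth smooth_submod_closed.

End Dim.

(* The inclusion (x_1, x_2) |-> (x_1, x_2, 0). *)
Definition emb (y : 'rV[R]_2) : 'rV[R]_3 := row_mx y (0 : 'rV[R]_1).

Lemma emb_continuous : continuous emb.
Proof.
move=> y A /nbhs_ballP[e e0 eA]; apply/nbhs_ballP; exists e => // z [_ yz].
apply: eA; split => // i j; rewrite /emb !mxE.
by case: splitP => k _; [exact: yz | exact: ballxx].
Qed.

Lemma emb_line (y : 'rV[R]_2) (j : 'I_2) (h : R) :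
  emb (h *: ebase j + y) = h *: ebase (lshift 1 j) + emb y.
Proof.
by rewrite /emb /ebase delta_mx_lshift scale_row_mx add_row_mx scaler0 addr0.
Qed.

Lemma diff_quotient_emb (f : 'rV[R]_3 -> R) (y : 'rV[R]_2) (j : 'I_2) :
  (fun h => h^-1 *: (((f \o emb) \o shift y) (h *: ebase j) - (f \o emb) y)) =
  (fun h => h^-1 *:
     ((f \o shift (emb y)) (h *: ebase (lshift 1 j)) - f (emb y))).
Proof. by apply/funext => h /=; rewrite emb_line. Qed.

Lemma derivable_emb (f : 'rV[R]_3 -> R) (y : 'rV[R]_2) (j : 'I_2) :
  derivable f (emb y) (ebase (lshift 1 j)) -> derivable (f \o emb) y (ebase j).
Proof. by rewrite /derivable diff_quotient_emb. Qed.

Lemma derive_emb (f : 'rV[R]_3 -> R) (y : 'rV[R]_2) (j : 'I_2) :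
  'D_(ebase j) (f \o emb) y = 'D_(ebase (lshift 1 j)) f (emb y).
Proof. by rewrite /derive diff_quotient_emb. Qed.

Lemma pderiv_emb (f : 'rV[R]_3 -> C) (j : 'I_2) :
  pderiv j (f \o emb) = pderiv (lshift 1 j) f \o emb.
Proof. by apply/funext => y; rewrite /pderiv /= -!derive_emb. Qed.

Lemma is_smooth_emb (f : 'rV[R]_3 -> C) : is_smooth f -> is_smooth (f \o emb).
Proof.
move=> sf s.
have -> : iterpd s (f \o emb) = iterpd [seq lshift 1 j | j <- s] f \o emb.
  by elim: s => //= j s ->; rewrite pderiv_emb.
set t := [seq _ | _ <- s]; have [fr fi fd] := sf t; split.
- by move=> y; exact: (@continuous_comp _ _ _ emb (cRe (iterpd t f)) y
    (@emb_continuous y) (fr (emb y))).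
- by move=> y; exact: (@continuous_comp _ _ _ emb (cIm (iterpd t f)) y
    (@emb_continuous y) (fi (emb y))).
- by move=> j y; have [dr di] := fd (lshift 1 j) (emb y); split;
    [exact: (@derivable_emb (cRe _)) dr | exact: (@derivable_emb (cIm _)) di].
Qed.

End SmoothFunctions.

(* Cinf R n is the complex vector space of smooth functions R^n -> C. *)
Record Cinf (R : realType) (n : nat) := MkCinf {
  cinf_fun :> 'rV[R]_n -> R[i] ;
  _ : cinf_fun \in smooth }.
HB.instance Definition _ (R : realType) n :=
  [isSub for @cinf_fun R n].
HB.instance Definition _ (R : realType) n := [Choice of Cinf R n by <:].
HB.instance Definition _ (R : realType) n :=
  [SubChoice_isSubLmodule of Cinf R n by <:].


Section Operators.
Context {R : realType}.
Local Notation C := R[i].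

Fact partial_subproof n (j : 'I_n) (f : Cinf R n) : pderiv j f \in smooth.
Proof. exact/smoothP/is_smooth_pderiv/smoothP/(valP f). Qed.
Definition partial n (j : 'I_n) (f : Cinf R n) : Cinf R n :=
  MkCinf (partial_subproof j f).

Fact rest_subproof (f : Cinf R 3) : f \o emb \in smooth.
Proof. exact/smoothP/is_smooth_emb/smoothP/(valP f). Qed.
Definition Rest (f : Cinf R 3) : Cinf R 2 := MkCinf (rest_subproof f).

Definition x1 : 'I_3 := @Ordinal 3 0 isT.
Definition x2 : 'I_3 := @Ordinal 3 1 isT.
Definition x3 : 'I_3 := @Ordinal 3 2 isT.

Definition dz (f : Cinf R 3) : Cinf R 3 :=
  2^-1 *: (partial x1 f - 'i%C *: partial x2 f).
Definition dzbar (f : Cinf R 3) : Cinf R 3 :=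
  2^-1 *: (partial x1 f + 'i%C *: partial x2 f).

Definition mlaplace (f : Cinf R 3) : Cinf R 3 :=
  - partial x1 (partial x1 f) - partial x2 (partial x2 f).

(* The renormalized Gegenbauer polynomial; for k <= [l/2] the product is
   Gamma(mu + l - k) / Gamma(mu + [(l+1)/2]). *)
Definition gegenbauer (mu : C) (l : nat) : {poly C} :=
  \sum_(k < l./2.+1)
    ((-1) ^+ k * (\prod_(l.+1./2 <= j < l - k) (mu + j%:R))
      / (k`! * (l - k.*2)`!)%:R) *: (2 *: 'X) ^+ (l - k.*2).

(* I_l g = x^(l/2) g(y / sqrt x), for g of degree at most l and with the parity
   of l, as a polynomial in y with coefficients in C[x]; see inflateE. *)
Definition inflate (l : nat) (g : {poly C}) : {poly {poly C}} :=
  \sum_(j < l.+1 | ~~ odd (l - j)) (g`_j *: 'X^((l - j)./2)) *: 'X^j.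

Lemma inflateE (l : nat) (g : {poly C}) (s y : C) : s != 0 ->
  (size g <= l.+1)%N -> (forall j, (j <= l)%N -> odd (l - j) -> g`_j = 0) ->
  (inflate l g).[y%:P].[s ^+ 2] = s ^+ l * g.[y / s].
Proof.
move=> s0 sg pg; rewrite (horner_coef_wide _ sg) mulr_sumr.
rewrite /inflate !horner_sum big_mkcond /=; apply: eq_bigr => j _.
have jl : (j <= l)%N by rewrite -ltnS.
have sE : s ^+ l = s ^+ (l - j) * s ^+ j by rewrite -exprD subnK.
case: ifPn => [ev|/negPn od]; last by rewrite pg // mul0r mulr0.
rewrite ![in LHS]hornerE -exprM mul2n even_halfK // sE expr_div_n.
move: (s ^+ (l - j)) (s ^+ j) (y ^+ j) (expf_neq0 j s0) => p q r q0.
have H (a u v w : C) : v != 0 -> a * u * w = u * v * (a * (w / v)).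
  by move=> ?; field.
exact: H.
Qed.

Lemma size_gegenbauer (mu : C) l : (size (gegenbauer mu l) <= l.+1)%N.
Proof.
rewrite (leq_trans (size_sum _ _ _)) //; apply/bigmax_leqP => k _.
rewrite exprZn !(leq_trans (size_scale_leq _ _)) // size_polyXn.
by rewrite ltnS leq_subr.
Qed.

Lemma gegenbauer_parity (mu : C) l j : (j <= l)%N -> odd (l - j) ->
  (gegenbauer mu l)`_j = 0.
Proof.
move=> jl od; rewrite coef_sum big1 // => k _.
rewrite coefZ exprZn coefZ coefXn; case: eqP => [jE|_]; last by rewrite !mulr0.
have kl : (k.*2 <= l)%N.
  by rewrite -geq_half_double -ltnS.
by move: od; rewrite jE subKn // odd_double.
Qed.

(* P(X, Y), for P in C[x][y] and X, Y operators on V. *)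
Definition op_eval (V : lmodType C) (P : {poly {poly C}}) (X Y : V -> V)
    (v : V) : V :=
  \sum_(j < size P) \sum_(k < size P`_j) P`_j`_k *: iter k X (iter j Y v).

(* Some a if nu - lam = a is a natural number, and None otherwise. *)
Definition natdiff (lam nu : C) : option nat :=
  if pselect (exists a : nat, nu - lam = a%:R) is left h
  then Some (projT1 (cid h)) else None.

Lemma natdiffE (lam nu : C) (a : nat) : nu - lam = a%:R -> natdiff lam nu = Some a.
Proof.
move=> E; rewrite /natdiff; case: pselect => [h|[]]; last by exists a.
case: cid => b /= Eb; congr Some; apply/eqP.
by rewrite -(eqr_nat C) -Eb E.
Qed.

(* The differential operator of which Ct is the restriction to x_3 = 0.  It
   vanishes if nu - lam is a negative integer, and, by convention, if nu - lam is
   not an integer. *)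
Definition gegenbauer_op (lam nu : C) (f : Cinf R 3) : Cinf R 3 :=
  if natdiff lam nu is Some l
  then op_eval (inflate l (gegenbauer (lam - 1) l)) mlaplace (partial x3) f
  else 0.

Definition Ct (lam nu : C) : Cinf R 3 -> Cinf R 2 :=
  Rest \o gegenbauer_op lam nu.

Definition gam (mu : C) (l : nat) : C := if odd l then 1 else mu + l%:R / 2.

(* Omega1 n is the space of smooth 1-forms on R^n, given by their coefficients in
   dx_1, ..., dx_n.  VField is C^oo(R^3, V^3), given by the coordinates in
   u_1, u_2, u_3. *)
Definition Omega1 (n : nat) := {ffun 'I_n -> Cinf R n}.
Definition VField := {ffun 'I_3 -> Cinf R 3}.

Definition u1 : 'I_3 := @Ordinal 3 0 isT.
Definition u2 : 'I_3 := @Ordinal 3 1 isT.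
Definition u3 : 'I_3 := @Ordinal 3 2 isT.

(* D (x) u_s^vee *)
Definition tens (D : Cinf R 3 -> Cinf R 2) (s : 'I_3) (F : VField) : Cinf R 2 :=
  D (F s).

(* Zero, by convention, if nu - lam is not a natural number. *)
Definition D1 (lam nu : C) : VField -> Cinf R 2 :=
  match natdiff lam nu with
  | Some 0 => tens Rest u1
  | Some a => fun F =>
      (lam + (a.-1./2)%:R) *: tens (Ct (lam + 1) (nu + 1)) u1 F
      + (2 * gam (lam - 1) a) *: tens (Ct (lam + 1) nu \o dzbar) u2 F
      + 4 *: tens (Ct (lam + 1) (nu - 1) \o dzbar \o dzbar) u3 F
  | None => fun=> 0
  end.

Definition Dm1 (lam nu : C) : VField -> Cinf R 2 :=
  match natdiff lam nu with
  | Some 0 => tens Rest u3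
  | Some a => fun F =>
      4 *: tens (Ct (lam + 1) (nu - 1) \o dz \o dz) u1 F
      - (2 * gam (lam - 1) a) *: tens (Ct (lam + 1) nu \o dz) u2 F
      + (lam + (a.-1./2)%:R) *: tens (Ct (lam + 1) (nu + 1)) u3 F
  | None => fun=> 0
  end.

(* A pair (psi_(-1), psi_1) is an element of
   C^oo(R^2, C_(-1)) (+) C^oo(R^2, C_1). *)
Definition in_m1 (psi : Cinf R 2) : Cinf R 2 * Cinf R 2 := (psi, 0).
Definition in_1 (psi : Cinf R 2) : Cinf R 2 * Cinf R 2 := (0, psi).

Definition dx1 (f : Cinf R 2) : Omega1 2 := [ffun j => if j == 0 then f else 0].
Definition dx2 (f : Cinf R 2) : Omega1 2 := [ffun j => if j == 1 then f else 0].

Definition iota_form (psi : Cinf R 2 * Cinf R 2) : Omega1 2 :=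
  (dx1 psi.1 + 'i%C *: dx2 psi.1) + (dx1 psi.2 - 'i%C *: dx2 psi.2).

Definition A_mx : 'M[C]_3 := \matrix_(i, j)
  nth 0 (nth [::] [:: [::    1;  0;   -1 ];
                      [:: - 'i%C;  0; - 'i%C ];
                      [::    0; -1;    0 ]] i) j.

(* A^-1 applied pointwise to a 1-form. *)
Definition A_inv (w : Omega1 3) : VField :=
  [ffun s => \sum_(j < 3) invmx A_mx s j *: w j].

Lemma A_invE (w : Omega1 3) : A_inv w = [ffun s : 'I_3 =>
  if s == u1 then 2^-1 *: (w x1 + 'i%C *: w x2)
  else if s == u2 then - w x3
  else 2^-1 *: (- w x1 + 'i%C *: w x2)] :> VField.
Proof.
pose B : 'M[C]_3 := \matrix_(i, j)
  nth 0 (nth [::] [:: [:: 2^-1; 2^-1 * 'i%C; 0 ]; [:: 0; 0; -1 ];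
                      [:: - 2^-1; 2^-1 * 'i%C; 0 ]] i) j.
have h2 : 2^-1 + 2^-1 = 1 :> C.
  by rewrite -[_ + _]mulr2n -(mulr_natr 2^-1 2) mulVf // pnatr_eq0.
have i2 (x : C) : 'i%C * (x * 'i%C) = - x.
  by rewrite mulrCA -expr2 sqr_i mulrN1.
have AB : A_mx *m B = 1%:M.
  apply/matrixP => i j; rewrite !mxE !big_ord_recr big_ord0 /= !mxE /=.
  case: i => [[|[|[|//]]] ?]; case: j => [[|[|[|//]]] ?] /=;
    rewrite ?(mul0r, mulr0, mul1r, mulr1, mulN1r, add0r, addr0, opprK, mulrNN,
      mulNr, i2, h2, subrr, mulrN1, oppr0, mulrN, addNr) //.
have uA := proj1 (mulmx1_unit AB).
have BE : invmx A_mx = B by rewrite -[B]mul1mx -(mulVmx uA) -mulmxA AB mulmx1.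
apply/ffunP => s; rewrite !ffunE BE !big_ord_recr big_ord0 /= !mxE add0r.
have e1 : widen_ord (leqnSn 2) (widen_ord (leqnSn 1) ord_max) = x1 by apply/val_inj.
have e2 : widen_ord (leqnSn 2) ord_max = x2 by apply/val_inj.
have e3 : ord_max = x3 by apply/val_inj.
rewrite e1 e2 e3.
case: s => [[|[|[|//]]] ?] /=; rewrite ?scale0r ?add0r ?addr0 ?scaleN1r //.
  by rewrite scalerDr scalerA.
by rewrite scalerDr scalerA scalerN scaleNr.
Qed.
Definition ext_d (n : nat) (f : Cinf R n) : Omega1 n := [ffun j => partial j f].
Definition codiff (n : nat) (w : Omega1 n) : Cinf R n :=
  - \sum_(j < n) partial j (w j).
(* Interior multiplication of a 1-form by the coordinate field d/dx_j. *)
Definition int_mul (n : nat) (j : 'I_n) (w : Omega1 n) : Cinf R n := w j.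

Definition coefwise (D : Cinf R 3 -> Cinf R 3) (w : Omega1 3) : Omega1 3 :=
  [ffun j => D (w j)].
(* The pull-back along emb, which sends dx_3 to 0. *)
Definition RestForm (w : Omega1 3) : Omega1 2 :=
  [ffun j : 'I_2 => Rest (w (lshift 1 j))].
Definition CtForm (lam nu : C) : Omega1 3 -> Omega1 2 :=
  RestForm \o coefwise (gegenbauer_op lam nu).

(* Zero, by convention, if nu - lam is not a natural number. *)
Definition Ct11 (lam nu : C) : Omega1 3 -> Omega1 2 :=
  match natdiff lam nu with
  | Some 0 => RestForm
  | Some a => fun w =>
      CtForm (lam + 1) (nu - 1) (ext_d (codiff w))
      - gam (lam - 3 / 2) a *: CtForm lam (nu - 1) (ext_d (int_mul x3 w))
      + ((lam + a%:R - 1) / 2) *: CtForm lam nu w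
  | None => fun=> 0
  end.

End Operators.

(* Main.v *)
(* Write G^mu_l for the two-variable polynomial I_l C^mu_l evaluated at
   X = - d_1^2 - d_2^2 and Y = d_3.  Comparing coefficients and using that partial
   derivatives commute, both sides agree as soon as
     (lam + [(a-1)/2]) G^lam_a - X G^lam_(a-2) = (lam + a - 1) G^(lam-1)_a,
     gam(lam - 1, a) G^lam_(a-1)
       = Y G^lam_(a-2) + gam(lam - 3/2, a) G^(lam-1)_(a-1),
   which are contiguity relations between renormalized Gegenbauer polynomials,
   checked coefficient by coefficient. *)

Require Import Defs.
From HB Require Import structures.
From mathcomp Require Import all_boot all_order all_algebra.
From mathcomp Require Import complex.
From mathcomp Require Import all_classical all_reals all_analysis.
From mathcomp Require Import ring zify.
Set Implicit Arguments.
Unset Strict Implicit.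
Unset Printing Implicit Defensive.
Import Order.TTheory GRing.Theory Num.Theory.
Import numFieldNormedType.Exports.
Local Open Scope ring_scope.
Local Open Scope complex_scope.

(** * Symmetry of mixed second directional derivatives *)

(** The two difference quotients are the same function of [h], so no differentiability beyond the
    direction [v] enters. *)
Lemma is_derive_line (R : realType) (V : normedModType R) (f : V -> R) (x v : V) (t : R) :
  derivable f (t *: v + x) v ->
  is_derive t 1 (fun s : R => f (s *: v + x)) ('D_v f (t *: v + x)).
Proof.
have E : (fun h : R => h^-1 *: (((fun s => f (s *: v + x)) \o shift t) (h *: 1)
      - f (t *: v + x))) =
    (fun h : R => h^-1 *: ((f \o shift (t *: v + x)) (h *: v) - f (t *: v + x))).
  by apply/funext => h; rewrite /= scalerDl addrA [h *: 1]mulr1.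
by move=> df; split; rewrite /derivable /derive E.
Qed.

(** The mean value theorem is applied twice: to [phi], the increment by [h *: v] moved along [u],
    and then to [psi], the derivative along [u] moved along [v]. *)
Lemma second_difference (R : realType) (V : normedModType R) (f : V -> R) (x u v : V) (h : R) :
  0 < h -> (forall y, derivable f y u) -> (forall y, derivable ('D_u f) y v) ->
  exists s t : R, [/\ 0 < s < h, 0 < t < h &
    f (h *: u + (h *: v + x)) - f (h *: u + x) - (f (h *: v + x) - f x)
    = 'D_v ('D_u f) (t *: v + (s *: u + x)) * h * h].
Proof.
move=> h0 df ddf.
pose phi (s : R) : R := f (s *: u + (h *: v + x)) - f (s *: u + x).
pose dphi (s : R) : R := 'D_u f (s *: u + (h *: v + x)) - 'D_u f (s *: u + x).
have phiP (s : R) : is_derive s 1 phi (dphi s).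
  by apply: is_deriveB; apply: is_derive_line.
have phiC : ({within `[0, h], continuous phi})%classic.
  by apply: derivable_within_continuous => s _; have [] := phiP s.
have [s] := MVT h0 (fun s _ => phiP s) phiC.
rewrite in_itv /= => sh phiE.
pose psi (t : R) : R := 'D_u f (t *: v + (s *: u + x)).
have psiP (t : R) : is_derive t 1 psi ('D_v ('D_u f) (t *: v + (s *: u + x))).
  exact: is_derive_line.
have psiC : ({within `[0, h], continuous psi})%classic.
  by apply: derivable_within_continuous => t _; have [] := psiP t.
have [t] := MVT h0 (fun t _ => psiP t) psiC.
rewrite in_itv /= => th psiE.
exists s, t; split => //.
move: phiE psiE; rewrite /phi /psi /dphi !scale0r !add0r !subr0 => -> <-.
by rewrite addrCA.
Qed.

(** Were the values distinct, continuity at half their distance would put a common value [F y = G z]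
    too close to both of them. *)
Lemma eq_of_near_eq (R : realType) (V : normedModType R) (F G : V -> R) (x : V) :
  {for x, continuous F} -> {for x, continuous G} ->
  (forall d, 0 < d -> exists y z, [/\ `|x - y| < d, `|x - z| < d & F y = G z]) ->
  F x = G x.
Proof.
move=> cF cG FG; apply/eqP/negP => /negP ne.
have e0 : 0 < `|F x - G x| / 2 by rewrite divr_gt0 // normr_gt0 subr_eq0.
have /cvgrPdist_lt/(_ _ e0)/nbhs_ballP[d1 /= d10 Fd] := cF.
have /cvgrPdist_lt/(_ _ e0)/nbhs_ballP[d2 /= d20 Gd] := cG.
have [|y [z [xy xz E]]] := FG (Num.min d1 d2); first by rewrite lt_min d10.
have Fy : `|F x - F y| < `|F x - G x| / 2.
  by apply: Fd; rewrite -ball_normE /= (lt_le_trans xy) // ge_min lexx.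
have Gz : `|G x - G z| < `|F x - G x| / 2.
  by apply: Gd; rewrite -ball_normE /= (lt_le_trans xz) // ge_min lexx orbT.
rewrite E in Fy; have := ltrD Fy Gz; rewrite -splitr (distrC (G x)) ltNge.
by move=> /negP; apply; rewrite -[leLHS]/`|F x - G x| -(subrKA (G z)) ler_normD.
Qed.

(** The second difference is symmetric in [u] and [v], so it gives a value of each mixed derivative;
    the two points tend to [x] with the step [h], and continuity concludes. *)
Lemma derive_comm (R : realType) (V : normedModType R) (f : V -> R) (u v : V) :
  (forall y, derivable f y u) -> (forall y, derivable f y v) ->
  (forall y, derivable ('D_u f) y v) -> (forall y, derivable ('D_v f) y u) ->
  continuous ('D_v ('D_u f)) -> continuous ('D_u ('D_v f)) ->
  'D_v ('D_u f) = 'D_u ('D_v f).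
Proof.
move=> fu fv fuv fvu cuv cvu; apply/funext => x.
apply: eq_of_near_eq (cuv x) (cvu x) _ => d d0.
(* The summand 1 keeps [m] positive when [u = v = 0] and makes [h * (|u| + |v|)] strictly less than
   [d]. *)
pose m := `|u| + `|v| + 1; have m0 : 0 < m by rewrite ltr_wpDl // addr_ge0.
pose h := d / m; have h0 : 0 < h by rewrite divr_gt0.
have near a b (p q : V) : 0 < a < h -> 0 < b < h -> `|p| + `|q| = `|u| + `|v| ->
    `|x - (a *: p + (b *: q + x))| < d.
  move=> /andP[a0 ah] /andP[b0 bh] pq.
  rewrite addrA opprD addrCA subrr addr0 normrN.
  rewrite (le_lt_trans (ler_normD _ _)) // !normrZ !gtr0_norm //.
  have : a * `|p| + b * `|q| <= h * (`|p| + `|q|).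
    by rewrite mulrDr lerD // ler_wpM2r // ltW.
  move/le_lt_trans; apply; rewrite pq /h mulrAC -mulrA gtr_pMr // ltr_pdivrMr //.
  by rewrite mul1r ltrDl.
have [s [t [sh th E1]]] := second_difference x h0 fu fuv.
have [t' [s' [t'h s'h E2]]] := second_difference x h0 fv fvu.
exists (t *: v + (s *: u + x)), (s' *: u + (t' *: v + x)).
split; [exact: near (addrC _ _) | exact: near | ].
apply: (mulIf (lt0r_neq0 h0)); apply: (mulIf (lt0r_neq0 h0)).
apply: etrans (esym E1) (etrans _ E2); rewrite (addrCA (h *: v)) -!addrA.
by congr (_ + _); rewrite !opprD !opprK addrCA.
Qed.

(** * Linearity of restriction; linearity and commutation of partial derivatives *)

Fact partial_is_linear (R : realType) n (j : 'I_n) : linear (@partial R n j).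
Proof.
move=> c f g; apply/val_inj => /=.
have df (h : Cinf R n) : pderivable h by have /smoothP/(_ [::])[] := valP h.
exact: (pderiv_lin c j (df f) (df g)).
Qed.
HB.instance Definition _ (R : realType) n (j : 'I_n) :=
  GRing.isLinear.Build R[i] (Cinf R n) (Cinf R n) *:%R (@partial R n j) (partial_is_linear j).

Fact Rest_is_linear (R : realType) : linear (@Rest R).
Proof. by move=> c f g; apply/val_inj. Qed.
HB.instance Definition _ (R : realType) :=
  GRing.isLinear.Build R[i] (Cinf R 3) (Cinf R 2) *:%R (@Rest R) (@Rest_is_linear R).

(** Symmetry of mixed derivatives is applied to the real and imaginary parts; smoothness along words
    of length at most two supplies its hypotheses. *)
Lemma partial_comm (R : realType) n (i j : 'I_n) (f : Cinf R n) :
  partial i (partial j f) = partial j (partial i f).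
Proof.
have /smoothP sf := valP f; apply/val_inj/funext => x /=; rewrite /pderiv.
have [_ _ d0] := sf [::]; have [_ _ di] := sf [:: i]; have [_ _ dj] := sf [:: j].
have [cij1 cij2 _] := sf [:: i; j]; have [cji1 cji2 _] := sf [:: j; i].
pose D k (h : 'rV[R]_n -> R) y : R := 'D_(ebase k) h y.
have CR : D i (D j (cRe f)) = D j (D i (cRe f)).
  apply: (derive_comm _ _ _ _ cij1 cji1) => y.
  - exact: (proj1 (d0 j y)).
  - exact: (proj1 (d0 i y)).
  - exact: (proj1 (dj i y)).
  - exact: (proj1 (di j y)).
have CI : D i (D j (cIm f)) = D j (D i (cIm f)).
  apply: (derive_comm _ _ _ _ cij2 cji2) => y.
  - exact: (proj2 (d0 j y)).
  - exact: (proj2 (d0 i y)).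
  - exact: (proj2 (dj i y)).
  - exact: (proj2 (di j y)).
exact: (congr2 (fun F G => F x +i* G x) CR CI).
Qed.

(** * Explicit expansion of the Gegenbauer operators *)

(* The coefficient of X^k Y^(l - 2k) in I_l C^mu_l. *)
Definition geg_coef (R : realType) (mu : R[i]) (l k : nat) : R[i] :=
  if (k.*2 <= l)%N then
    (-1) ^+ k * (\prod_(l.+1./2 <= j < l - k) (mu + j%:R))
      / (k`! * (l - k.*2)`!)%:R * 2 ^+ (l - k.*2)
  else 0.

Lemma coef_gegenbauer (R : realType) (mu : R[i]) (l k : nat) : (k.*2 <= l)%N ->
  (gegenbauer mu l)`_(l - k.*2) = geg_coef mu l k.
Proof.
move=> kl; rewrite /geg_coef kl /gegenbauer coef_sum.
have kl2 : (k < l./2.+1)%N by rewrite ltnS; lia.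
rewrite (bigD1 (Ordinal kl2)) //= [X in _ + X]big1 => [|i].
  by rewrite exprZn !coefZ coefXn eqxx mulr1 addr0.
rewrite exprZn !coefZ coefXn.
rewrite -val_eqE /= => ik; case: eqP => [E|_]; last by rewrite !mulr0.
by have := ltn_ord i; lia.
Qed.

(** Coefficients beyond the size vanish, so the bounds can be made independent of the actual
    degrees, which may drop for special parameters. *)
Lemma op_eval_wide (R : realType) (V : lmodType R[i]) (P : {poly {poly R[i]}})
    (X Y : V -> V) (v : V) (M N : nat) :
  (size P <= N)%N -> (forall j, (size (P`_j)%R <= M)%N) ->
  op_eval P X Y v = \sum_(j < N) \sum_(k < M) P`_j`_k *: iter k X (iter j Y v).
Proof.
move=> PN PM; rewrite /op_eval.
have E j : \sum_(k < size P`_j) P`_j`_k *: iter k X (iter j Y v) =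
           \sum_(k < M) P`_j`_k *: iter k X (iter j Y v).
  rewrite (big_ord_widen M (fun k => P`_j`_k *: iter k X (iter j Y v))) // big_mkcond.
  by apply: eq_bigr => k _; case: ltnP => // kP; rewrite [_`__]nth_default ?scale0r.
rewrite (big_ord_widen N (fun j => \sum_(k < size P`_j) P`_j`_k *: iter k X (iter j Y v))) //.
rewrite big_mkcond; apply: eq_bigr => j _; rewrite E; case: ltnP => // jP.
by rewrite [P`_j]nth_default // big1 // => k _; rewrite coef0 scale0r.
Qed.

Lemma op_eval_gegenbauer (R : realType) (V : lmodType R[i]) (mu : R[i]) (l : nat)
    (X Y : V -> V) (v : V) :
  op_eval (inflate l (gegenbauer mu l)) X Y v =
  \sum_(k < l.+1) geg_coef mu l k *: iter k X (iter (l - k.*2) Y v).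
Proof.
set g := gegenbauer mu l.
have iE : inflate l g =
    \poly_(j < l.+1) (if ~~ odd (l - j) then g`_j *: 'X^((l - j)./2) else 0).
  by rewrite poly_def /inflate big_mkcond; apply: eq_bigr => j _; case: ifP; rewrite ?scale0r.
have cE j : (inflate l g)`_j =
    if (j <= l)%N && ~~ odd (l - j) then g`_j *: 'X^((l - j)./2) else 0.
  by rewrite iE coef_poly ltnS; case: leqP.
rewrite (@op_eval_wide _ _ _ _ _ _ l.+1 l.+1); first last.
- move=> j; rewrite cE; case: ifP => _; last by rewrite size_poly0.
  by rewrite (leq_trans (size_scale_leq _ _)) // size_polyXn; lia.
- by rewrite iE size_poly.
rewrite exchange_big; apply: eq_bigr => k _ /=.
(* For fixed [k] the only contributing exponent of Y is [j = l - 2k], which exists exactly when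
   [2k <= l]. *)
have [kl|lk] := leqP k.*2 l; last first.
  rewrite /geg_coef leqNgt lk scale0r big1 // => j _; rewrite cE.
  case: ifP => [/andP[jl od]|_]; last by rewrite coef0 scale0r.
  rewrite coefZ coefXn; case: eqP => [kE|_]; last by rewrite mulr0 scale0r.
  by move: od; rewrite kE in lk *; lia.
have jl : (l - k.*2 < l.+1)%N by lia.
rewrite (bigD1 (Ordinal jl)) //= [X in _ + X]big1 => [|j]; rewrite cE.
  rewrite ifT; last by lia.
  rewrite coefZ coefXn coef_gegenbauer // subKn // doubleK eqxx mulr1 addr0.
  by [].
rewrite -val_eqE /= => jk.
case: ifP => [/andP[jl' od]|_]; last by rewrite coef0 scale0r.
rewrite coefZ coefXn; case: eqP => [kE|_]; last by rewrite mulr0 scale0r.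
by have := ltn_ord j; lia.
Qed.

(** * Contiguity relations between coefficients *)

Lemma prod_shift_index (R : realType) (mu : R[i]) (m n : nat) :
  \prod_(m.+1 <= j < n.+1) (mu - 1 + j%:R) = \prod_(m <= j < n) (mu + j%:R).
Proof. by rewrite big_add1 /=; apply: eq_bigr => j _; rewrite -natr1; ring. Qed.

(** Both sides are the product of [mu + j] over [m <= j <= n], with the first or the last factor
    split off. *)
Lemma prod_shift_range (R : realType) (mu : R[i]) (m n : nat) : (m <= n)%N ->
  (mu + m%:R) * \prod_(m.+1 <= j < n.+1) (mu + j%:R)
  = \prod_(m <= j < n) (mu + j%:R) * (mu + n%:R).
Proof. by move=> mn; rewrite -big_ltn ?ltnS // big_nat_recr. Qed.

Lemma geg_coef_contiguous2_0 (R : realType) (lam : R[i]) (l : nat) :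
  (lam + (l.+1./2)%:R) * geg_coef lam l.+2 0
  = (lam + l.+1%:R) * geg_coef (lam - 1) l.+2 0.
Proof.
rewrite /geg_coef /= !subn0 expr0 !mul1r uphalfE prod_shift_index.
rewrite !mulrA prod_shift_range; last by lia.
by rewrite [X in X / _]mulrC.
Qed.

(** Up to common factors the left side is [-(P * (lam + l - k) / (k + 1) + P)] by
    [prod_shift_range], and the numerators add up to [lam + l + 1]. *)
Lemma geg_coef_contiguous2_S (R : realType) (lam : R[i]) (l k : nat) :
  (lam + (l.+1./2)%:R) * geg_coef lam l.+2 k.+1 - geg_coef lam l k
  = (lam + l.+1%:R) * geg_coef (lam - 1) l.+2 k.+1.
Proof.
rewrite /geg_coef doubleS !ltnS; case: leqP => kl; last by rewrite !mulr0 subr0.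
have -> : (l.+2 - k.*2.+2 = l - k.*2)%N by lia.
have -> : (l.+2 - k.+1 = (l - k).+1)%N by lia.
have -> : (l.+3./2 = l.+1./2.+1)%N by lia.
rewrite prod_shift_index factS !natrM.
have := prod_shift_range lam (_ : l.+1./2 <= l - k)%N.
move=> /(_ ltac:(lia)).
set P1 := \prod_(_.+1 <= j < _) _; set P := \prod_(_ <= j < _) _ => E.
have lkE : (l - k)%:R = l%:R - k%:R :> R[i] by rewrite natrB //; lia.
have k0 : (k%:R + 1 : R[i]) != 0 by rewrite natr1 pnatr_eq0.
have f0 : (k`!)%:R != 0 :> R[i] by rewrite pnatr_eq0 -lt0n fact_gt0.
have g0 : ((l - k.*2)`!)%:R != 0 :> R[i] by rewrite pnatr_eq0 -lt0n fact_gt0.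
rewrite lkE in E; rewrite exprS -[k.+1%:R]natr1 -[l.+1%:R]natr1.
move: E k0 f0 g0; move: (lam + _%:R) (k`!%:R) ((l - k.*2)`!%:R) ((-1) ^+ k) (2 ^+ _) => c f g s t.
move: P1 P (k%:R) (l%:R) => p1 p k' l' E k0 f0 g0.
(* This grouping isolates [c * p1], to which [E] applies. *)
transitivity (- (c * p1 / (k' + 1) + p) * s / f / g * t); first by field; rewrite g0 f0 k0.
by rewrite E; field; rewrite g0 f0 k0.
Qed.

Lemma geg_coef_contiguous1 (R : realType) (lam : R[i]) (l k : nat) :
  gam (lam - 1) l.+2 * geg_coef lam l.+1 k
  = geg_coef lam l k + gam (lam - 3 / 2) l.+2 * geg_coef (lam - 1) l.+1 k.
Proof.
rewrite /gam /geg_coef /= negbK; have [kl|lk] := leqP k.*2 l; last first.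
  (* The index left is [2k = l + 1], with [l] odd: both factors [gam] are 1 and both products are
     empty. *)
  have [kl|_] := leqP k.*2 l.+1; last by rewrite !mulr0 add0r.
  have -> : odd l by lia.
  by rewrite !big_geq ?add0r //; lia.
rewrite leqW // !subSn //; last by lia.
rewrite prod_shift_index factS !natrM exprS -[(l - k.*2).+1%:R]natr1 -[l.+2%:R]natr1.
rewrite -[l.+1%:R]natr1.
have lE : l%:R = (odd l)%:R + 2 * (l./2)%:R :> R[i].
  by rewrite -[in LHS](odd_double_half l) natrD -muln2 natrM mulrC.
have lkE : (l - k)%:R = l%:R - k%:R :> R[i] by rewrite natrB //; lia.
have lkkE : (l - k.*2)%:R = l%:R - 2 * k%:R :> R[i] by rewrite natrB // -muln2 natrM mulrC.
have f0 : (k`!)%:R != 0 :> R[i] by rewrite pnatr_eq0 -lt0n fact_gt0.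
have g0 : ((l - k.*2)`!)%:R != 0 :> R[i] by rewrite pnatr_eq0 -lt0n fact_gt0.
have h0 : (l%:R - 2 * k%:R + 1) != 0 :> R[i].
  by rewrite -lkkE natr1 pnatr_eq0.
rewrite lkkE.
have [od|ev] := boolP (odd l).
  (* For odd [l] both factors [gam] are 1, and the three products differ only by the last factor on
     the left and the first factor in the last term. *)
  have -> : uphalf l = l./2.+1 by rewrite uphalf_half od.
  rewrite [X in _ = _ + X]mul1r [LHS]mul1r.
  rewrite big_nat_recr /=; last by lia.
  rewrite [\prod_(l./2 <= _ < _) _]big_ltn; last by lia.
  rewrite lkE {}lE od /= in h0 *.
  move: h0 f0 g0; move: (\prod_(_ <= _ < _) _) (k`!%:R) ((l - k.*2)`!%:R) ((-1) ^+ k) (2 ^+ _) => p f g s t.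
  by move: (k%:R) (l./2%:R) => k' m h0 f0 g0; field; rewrite ?g0 ?f0 ?h0 //.
(* For even [l] the left factor [gam] is [lam + l/2], which [prod_shift_range] absorbs into the
   product. *)
have -> : uphalf l = l./2 by rewrite uphalf_half (negbTE ev).
have := prod_shift_range lam (_ : l./2 <= l - k)%N.
move=> /(_ ltac:(lia)).
move: (\prod_(_.+1 <= _ < _) _) (\prod_(l./2 <= _ < _) _) => p1 p.
rewrite lkE {}lE (negbTE ev) add0r in h0 *.
move: h0 f0 g0; move: (k`!%:R) ((l - k.*2)`!%:R) ((-1) ^+ k) (2 ^+ _) => f g s t.
move: (k%:R) (l./2%:R) => k' m h0 f0 g0 E.
transitivity (((lam + m) * p1) * 2 * s * t / f / g / (2 * m - 2 * k' + 1)).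
  by field; rewrite ?g0 ?f0 ?h0 //.
by rewrite E; field; rewrite ?g0 ?f0 ?h0 //.
Qed.

Lemma geg_coef_eq0 (R : realType) (mu : R[i]) (l k : nat) :
  (l < k.*2)%N -> geg_coef mu l k = 0.
Proof. by rewrite /geg_coef ltnNge => /negbTE ->. Qed.

(** * Contiguity relations between operators on a module *)

Definition geg_op (R : realType) (V : lmodType R[i]) (X Y : V -> V) (mu : R[i]) (l : nat) : V -> V :=
  op_eval (inflate l (gegenbauer mu l)) X Y.

Lemma geg_opE (R : realType) (V : lmodType R[i]) (X Y : V -> V) (mu : R[i]) (l : nat) (v : V) :
  geg_op X Y mu l v = \sum_(k < l.+1) geg_coef mu l k *: iter k X (iter (l - k.*2) Y v).
Proof. exact: op_eval_gegenbauer. Qed.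

(* The extra index l + 1 contributes 0; it aligns this sum with those of degree l + 1
   and l + 2 in the contiguity relations. *)
Lemma geg_op_wide (R : realType) (V : lmodType R[i]) (X Y : V -> V) (mu : R[i]) (l : nat) (v : V) :
  geg_op X Y mu l v = \sum_(k < l.+2) geg_coef mu l k *: iter k X (iter (l - k.*2) Y v).
Proof.
rewrite big_ord_recr /= geg_coef_eq0 ?scale0r ?addr0; last by lia.
exact: op_eval_gegenbauer.
Qed.

Lemma iter_is_linear (R : realType) (V : lmodType R[i]) (X : {linear V -> V}) (k : nat) :
  linear (iter k X).
Proof. by move=> c u v; elim: k => //= k ->; rewrite linearP. Qed.

Lemma geg_op_is_linear (R : realType) (V : lmodType R[i]) (X Y : {linear V -> V}) (mu : R[i]) (l : nat) :
  linear (geg_op X Y mu l).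
Proof.
move=> c u v; rewrite !geg_op_wide scaler_sumr -big_split; apply: eq_bigr => k _ /=.
by rewrite !iter_is_linear scalerDr !scalerA (mulrC c).
Qed.

Lemma iter_comm (T : Type) (f g : T -> T) (k : nat) : (forall x, f (g x) = g (f x)) ->
  forall x, iter k f (g x) = g (iter k f x).
Proof. by move=> fg x; elim: k => //= k ->. Qed.

Lemma geg_op_comm (R : realType) (V : lmodType R[i]) (X Y : V -> V) (Z : {linear V -> V}) (mu : R[i]) (l : nat) :
  (forall v, X (Z v) = Z (X v)) -> (forall v, Y (Z v) = Z (Y v)) ->
  forall v, geg_op X Y mu l (Z v) = Z (geg_op X Y mu l v).
Proof.
move=> XZ YZ v; rewrite !geg_op_wide linear_sum; apply: eq_bigr => k _.
by rewrite linearZ /= (iter_comm _ YZ) (iter_comm _ XZ).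
Qed.

Lemma geg_op_contiguous2 (R : realType) (V : lmodType R[i]) (X : {linear V -> V}) (Y : V -> V)
    (lam : R[i]) (l : nat) (v : V) :
  (lam + (l.+1./2)%:R) *: geg_op X Y lam l.+2 v - X (geg_op X Y lam l v)
  = (lam + l.+1%:R) *: geg_op X Y (lam - 1) l.+2 v.
Proof.
rewrite (geg_op_wide X Y lam l) !geg_opE.
(* Applying X raises the power of X by one, so the term [k = 0] stands alone and the term [k] of
   degree [l] meets [k + 1] in degree [l + 2]. *)
rewrite !(big_ord_recl l.+2) !scalerDr !scalerA geg_coef_contiguous2_0 -addrA; congr (_ + _).
rewrite !scaler_sumr linear_sum -sumrB; apply: eq_bigr => k _.
rewrite !scalerA linearZ /= -geg_coef_contiguous2_S scalerBl.
by rewrite /bump /= add1n doubleS !subSS.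
Qed.

Lemma geg_op_contiguous1 (R : realType) (V : lmodType R[i]) (X : V -> V) (Y : {linear V -> V})
    (lam : R[i]) (l : nat) (v : V) : (forall v, X (Y v) = Y (X v)) ->
  gam (lam - 1) l.+2 *: geg_op X Y lam l.+1 v
  = Y (geg_op X Y lam l v) + gam (lam - 3 / 2) l.+2 *: geg_op X Y (lam - 1) l.+1 v.
Proof.
move=> XY; rewrite (geg_op_wide X Y lam l) !geg_opE.
rewrite !scaler_sumr linear_sum -big_split; apply: eq_bigr => k _ /=.
rewrite !scalerA geg_coef_contiguous1 scalerDl linearZ /=; congr (_ + _).
(* For [2k > l] truncated subtraction would give the wrong power of Y, but the coefficient is
   zero. *)
have [kl|lk] := leqP k.*2 l; last by rewrite geg_coef_eq0 // !scale0r.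
by rewrite subSn // iterS (iter_comm _ XY).
Qed.

(** * Specialization to differential operators on smooth functions *)

Fact mlaplace_is_linear (R : realType) : linear (@mlaplace R).
Proof.
move=> c f g; by rewrite /mlaplace !linearP /= addrACA -scalerDr.
Qed.
HB.instance Definition _ (R : realType) :=
  GRing.isLinear.Build R[i] (Cinf R 3) (Cinf R 3) *:%R (@mlaplace R) (@mlaplace_is_linear R).

Lemma mlaplace_partial (R : realType) (j : 'I_3) (f : Cinf R 3) :
  mlaplace (partial j f) = partial j (mlaplace f).
Proof.
have E i : partial i (partial i (partial j f)) = partial j (partial i (partial i f)).
  by rewrite (partial_comm i j f) (partial_comm i j (partial i f)).
by rewrite /mlaplace (E x1) (E x2) (linearB (partial j)) (linearN (partial j)).
Qed.

Lemma gegenbauer_opE (R : realType) (lam nu : R[i]) (l : nat) : nu - lam = l%:R ->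
  gegenbauer_op lam nu = geg_op (@mlaplace R) (partial x3) (lam - 1) l.
Proof. by move=> E; apply/funext => f; rewrite /gegenbauer_op (natdiffE E). Qed.

Fact gegenbauer_op_is_linear (R : realType) (lam nu : R[i]) :
  linear (gegenbauer_op lam nu).
Proof.
rewrite /gegenbauer_op; case: natdiff => [l|]; first exact: geg_op_is_linear.
by move=> c f g; rewrite scaler0 addr0.
Qed.
HB.instance Definition _ (R : realType) (lam nu : R[i]) :=
  GRing.isLinear.Build R[i] (Cinf R 3) (Cinf R 3) *:%R (gegenbauer_op lam nu)
    (gegenbauer_op_is_linear lam nu).

Lemma gegenbauer_op_partial (R : realType) (lam nu : R[i]) (j : 'I_3) (f : Cinf R 3) :
  gegenbauer_op lam nu (partial j f) = partial j (gegenbauer_op lam nu f).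
Proof.
rewrite /gegenbauer_op; case: natdiff => [l|]; last by rewrite linear0.
apply: geg_op_comm => v; [exact: mlaplace_partial | exact: partial_comm].
Qed.

(** The difference of the parameters is -1. This is the term of degree [a - 2] for operators of
    order [a = 1]. *)
Lemma gegenbauer_op_neg1 (R : realType) (lam : R[i]) (f : Cinf R 3) :
  gegenbauer_op (lam + 1) lam f = 0.
Proof.
rewrite /gegenbauer_op /natdiff; case: pselect => // h; exfalso; case: h => a.
rewrite opprD addrA subrr add0r => /eqP.
by rewrite eq_sym -subr_eq0 opprK natr1 pnatr_eq0.
Qed.

Lemma geg_op0 (R : realType) (V : lmodType R[i]) (X Y : V -> V) (mu : R[i]) (v : V) :
  geg_op X Y mu 0 v = v.
Proof.
rewrite geg_opE big_ord1 /geg_coef /= big_geq //.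
by rewrite !expr0 fact0 muln1 divr1 !mulr1 scale1r.
Qed.

Lemma geg_op1 (R : realType) (V : lmodType R[i]) (X Y : V -> V) (mu : R[i]) (v : V) :
  geg_op X Y mu 1 v = 2 *: Y v.
Proof.
rewrite geg_opE !big_ord_recl big_ord0 addr0 [X in _ + X *: _]geg_coef_eq0 // scale0r addr0.
by rewrite /geg_coef /= big_geq // expr0 expr1 fact0 divr1 !mul1r.
Qed.

(** The order is [a + 1], so [[(order - 1)/2]] reads [a./2]. Order 1 is separate: its lowest term
    has degree -1, and both operators of degree 1 are twice the derivative in [x3]. *)
Lemma gegenbauer_op_contiguous2 (R : realType) (lam nu : R[i]) (a : nat) (f : Cinf R 3) :
  nu - lam = a.+1%:R ->
  (lam + (a./2)%:R) *: gegenbauer_op (lam + 1) (nu + 1) f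
    - mlaplace (gegenbauer_op (lam + 1) (nu - 1) f)
  = (lam + a%:R) *: gegenbauer_op lam nu f.
Proof.
move=> E; rewrite (gegenbauer_opE E) (@gegenbauer_opE _ _ (nu + 1) a.+1); last first.
  by rewrite -E; ring.
rewrite addrK; case: a E => [|a] E.
  have -> : nu - 1 = lam by rewrite -(subrK lam nu) E; ring.
  by rewrite gegenbauer_op_neg1 linear0 subr0 !geg_op1.
rewrite (@gegenbauer_opE _ _ (nu - 1) a); last first.
  by rewrite -(subrK lam nu) E -!natr1; ring.
by rewrite addrK; apply: (geg_op_contiguous2 (@mlaplace R)).
Qed.

Lemma gegenbauer_op_contiguous1 (R : realType) (lam nu : R[i]) (a : nat) (f : Cinf R 3) :
  nu - lam = a.+1%:R ->
  gam (lam - 1) a.+1 *: gegenbauer_op (lam + 1) nu f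
  = partial x3 (gegenbauer_op (lam + 1) (nu - 1) f)
    + gam (lam - 3 / 2) a.+1 *: gegenbauer_op lam (nu - 1) f.
Proof.
move=> E; have nuE : nu = lam + a%:R + 1 by rewrite -(subrK lam nu) E -natr1; ring.
rewrite (@gegenbauer_opE _ (lam + 1) nu a); last by rewrite nuE; ring.
rewrite (@gegenbauer_opE _ lam (nu - 1) a); last by rewrite nuE; ring.
rewrite addrK; case: a nuE {E} => [|a] nuE.
  have -> : nu - 1 = lam by rewrite nuE; ring.
  by rewrite gegenbauer_op_neg1 linear0 add0r !geg_op0.
rewrite (@gegenbauer_opE _ _ (nu - 1) a); last by rewrite nuE -natr1; ring.
rewrite addrK; apply: (@geg_op_contiguous1 _ _ (@mlaplace R) (partial x3)) => v.
exact: mlaplace_partial.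
Qed.

(** * Both sides of the identity in coordinates *)

Lemma iota_form_diff0 (R : realType) (f g : Cinf R 2) :
  iota_form (in_1 f - in_m1 g) 0 = f - g.
Proof.
rewrite /iota_form /dx1 /dx2 !ffunE /= !scaler0 addr0 subr0.
by rewrite add0r subr0 addrC.
Qed.

(** The coefficient of the second differential is [i (psi_(-1) - psi_1)], with [psi_1 = f] and
    [psi_(-1) = -g]. *)
Lemma iota_form_diff1 (R : realType) (f g : Cinf R 2) :
  iota_form (in_1 f - in_m1 g) 1 = - ('i%C *: (f + g)).
Proof.
rewrite /iota_form /dx1 /dx2 !ffunE /= !add0r.
by rewrite subr0 scalerN -opprD -scalerDr addrC.
Qed.

Lemma codiff3 (R : realType) (w : Omega1 3) :
  codiff w = - (partial x1 (w x1) + partial x2 (w x2) + partial x3 (w x3)) :> Cinf R 3.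
Proof.
rewrite /codiff !big_ord_recr big_ord0 /= add0r.
have e1 : widen_ord (leqnSn 2) (widen_ord (leqnSn 1) ord_max) = x1 by exact/val_inj.
have e2 : widen_ord (leqnSn 2) ord_max = x2 by exact/val_inj.
have e3 : ord_max = x3 by exact/val_inj.
by rewrite e1 e2 e3.
Qed.

(** Gathering everything under one [Rest] lets the identity be checked in three variables, at the
    points [emb y]. *)
Lemma Ct11E (R : realType) (lam nu : R[i]) (a : nat) (w : Omega1 3) (j : 'I_2) :
  nu - lam = a.+1%:R ->
  Ct11 lam nu w j =
  Rest (gegenbauer_op (lam + 1) (nu - 1) (partial (lshift 1 j) (codiff w))
        - gam (lam - 3 / 2) a.+1 *:
            gegenbauer_op lam (nu - 1) (partial (lshift 1 j) (w x3))
        + ((lam + a%:R) / 2) *: gegenbauer_op lam nu (w (lshift 1 j))).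
Proof.
move=> ha; have aE : lam + a.+1%:R - 1 = lam + a%:R by rewrite -natr1; ring.
rewrite /Ct11 (natdiffE ha) aE linearD linearB !linearZ /=.
by rewrite /CtForm /RestForm /coefwise /ext_d /= !ffunE.
Qed.

Lemma D1E (R : realType) (lam nu : R[i]) (a : nat) (F : VField) :
  nu - lam = a.+1%:R ->
  D1 lam nu F =
  Rest ((lam + (a./2)%:R) *: gegenbauer_op (lam + 1) (nu + 1) (F u1)
      + (2 * gam (lam - 1) a.+1) *: gegenbauer_op (lam + 1) nu (dzbar (F u2))
      + 4 *: gegenbauer_op (lam + 1) (nu - 1) (dzbar (dzbar (F u3)))).
Proof. by move=> ha; rewrite /D1 (natdiffE ha); apply/val_inj. Qed.

Lemma Dm1E (R : realType) (lam nu : R[i]) (a : nat) (F : VField) :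
  nu - lam = a.+1%:R ->
  Dm1 lam nu F =
  Rest (4 *: gegenbauer_op (lam + 1) (nu - 1) (dz (dz (F u1)))
      - (2 * gam (lam - 1) a.+1) *: gegenbauer_op (lam + 1) nu (dz (F u2))
      + (lam + (a./2)%:R) *: gegenbauer_op (lam + 1) (nu + 1) (F u3)).
Proof. by move=> ha; rewrite /Dm1 (natdiffE ha); apply/val_inj. Qed.


(** * Reduction to a scalar identity *)

(** A bundle of rewrite rules for maps whose linearity is only a hypothesis. *)
Lemma linear_rules (A : pzRingType) (V W : lmodType A) (f : V -> W) : linear f ->
  (forall u v, f (u + v) = f u + f v) * (forall v, f (- v) = - f v) *
  (forall k v, f (k *: v) = k *: f v).
Proof.
move=> fP; pose F : {linear V -> W} := HB.pack f (GRing.isLinear.Build _ _ _ _ f fP).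
by split; [split|]; [exact: (linearD F) | exact: (linearN F) | exact: (linearZ_LR F)].
Qed.

(* The algebraic core: d_1, d_2, d_3 stand for the partial derivatives, G0, G1, G2,
   H0, H1 for G^lam_a, G^lam_(a-1), G^lam_(a-2), G^(lam-1)_a, G^(lam-1)_(a-1), and ev
   for evaluation at a point, which turns the module identity into one in R[i]. *)
Lemma symbol_identity (R : realType) (V : lmodType R[i])
    (d1 d2 d3 G0 G1 G2 H0 H1 : V -> V) (ev : V -> R[i]^o)
    (c g g' b : R[i]) (f1 f2 f3 : V) :
  let i := 'i%C : R[i] in
  let z f := 2^-1 *: (d1 f - i *: d2 f) in
  let zb f := 2^-1 *: (d1 f + i *: d2 f) in
  let F1 := 2^-1 *: (f1 + i *: f2) in
  let F3 := 2^-1 *: (- f1 + i *: f2) in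
  let D := c *: G0 F1 + (2 * g) *: G1 (zb (- f3)) + 4 *: G2 (zb (zb F3)) in
  let Dm := 4 *: G2 (z (z F1)) - (2 * g) *: G1 (z (- f3)) + c *: G0 F3 in
  let T (d : V -> V) f := G2 (d (- (d1 f1 + d2 f2 + d3 f3))) - g' *: H1 (d f3) + (b / 2) *: H0 f in
  linear d1 -> linear d2 -> linear d3 ->
  linear G0 -> linear G1 -> linear G2 -> linear H0 -> linear H1 -> linear ev ->
  (forall f, d2 (d1 f) = d1 (d2 f)) ->
  (forall f, d3 (d1 f) = d1 (d3 f)) ->
  (forall f, d3 (d2 f) = d2 (d3 f)) ->
  (forall f, c *: G0 f + (G2 (d1 (d1 f)) + G2 (d2 (d2 f))) = b *: H0 f) ->
  (forall f, g *: G1 f = G2 (d3 f) + g' *: H1 f) ->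
  ev (D - Dm) = 2 * ev (T d1 f1) /\ - (i * ev (D + Dm)) = 2 * ev (T d2 f2).
Proof.
move=> i z zb F1 F3 D Dm T l1 l2 l3 lG0 lG1 lG2 lH0 lH1 lev c12 c13 c23 R2 R1.
have ii : i * i = -1 by rewrite /i -expr2 sqr_i.
have [[evD evN] evZ'] := linear_rules lev.
have evZ k f : ev (k *: f) = k * ev f by exact: evZ'.
have E2 f : c * ev (G0 f) + (ev (G2 (d1 (d1 f))) + ev (G2 (d2 (d2 f)))) = b * ev (H0 f).
  by rewrite -!(evD, evZ) R2.
have E1 f : g * ev (G1 f) = ev (G2 (d3 f)) + g' * ev (H1 f).
  by rewrite -!(evD, evZ) R1.
(* Four instances suffice: the second-order relation at [f1] and [f2], the first-order one at
   [d1 f3] and [d2 f3]. *)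
have {R2 E2}[E21 E22] := (E2 f1, E2 f2).
have {R1 E1}[E11 E12] := (E1 (d1 f3), E1 (d2 f3)).
rewrite c13 in E11; rewrite c23 in E12.
rewrite /D /Dm /T /F1 /F3 /z /zb; clearbody i; clear D Dm T F1 F3 z zb.
rewrite !(linear_rules l1, linear_rules l2, linear_rules l3).
rewrite !(linear_rules lG0, linear_rules lG1, linear_rules lG2, linear_rules lH0, linear_rules lH1).
rewrite !(evD, evN, evZ) !c12.
(* After expansion only these sixteen scalars occur; they become variables of a polynomial
   identity. *)
move: (ev (G0 f1) : R[i]) (ev (G0 f2) : R[i]) (ev (G1 (d1 f3)) : R[i]) (ev (G1 (d2 f3)) : R[i])
  (ev (G2 (d1 (d1 f1))) : R[i]) (ev (G2 (d1 (d1 f2))) : R[i]) (ev (G2 (d1 (d2 f1))) : R[i])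
  (ev (G2 (d1 (d2 f2))) : R[i]) (ev (G2 (d2 (d2 f1))) : R[i]) (ev (G2 (d2 (d2 f2))) : R[i])
  (ev (G2 (d1 (d3 f3))) : R[i]) (ev (G2 (d2 (d3 f3))) : R[i]) (ev (H0 f1) : R[i]) (ev (H0 f2) : R[i])
  (ev (H1 (d1 f3)) : R[i]) (ev (H1 (d2 f3)) : R[i]) E21 E22 E11 E12.
move=> g01 g02 q1 q2 p111 p112 p121 p122 p221 p222 p13 p23 h1 h2 r1 r2 /= E21 E22 E11 E12.
move: ii E21 E22 E11 E12 => /eqP; rewrite -addr_eq0 => /eqP ii.
move=> /eqP; rewrite -subr_eq0 => /eqP E21 /eqP; rewrite -subr_eq0 => /eqP E22.
move=> /eqP; rewrite -subr_eq0 => /eqP E11 /eqP; rewrite -subr_eq0 => /eqP E12.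
(* Each difference of the two sides is a combination of the relations and of
   i^2 + 1. *)
split; apply/subr0_eq.
  transitivity ((c * g01 + (p111 + p221) - b * h1) - 2 * (g * q1 - (p13 + g' * r1))
    + (i * i + 1) * (2 * p122 - p221)); first by field.
  by rewrite E21 E11 ii; ring.
transitivity ((c * g02 + (p112 + p222) - b * h2) - 2 * (g * q2 - (p23 + g' * r2))
  + (i * i + 1) * (- c * g02 + 2 * g * q2 + 2 * p121 - p112 - (i * i - 1) * p222)).
  by field.
by rewrite E22 E12 ii; ring.
Qed.

(** * The identity in order zero and in positive order *)

Theorem proposition9p1 (R : realType) (lam nu : R[i]) (a : nat)
    (ha : nu - lam = a%:R) :
  iota_form \o ((in_1 \o D1 lam nu) \- (in_m1 \o Dm1 lam nu)) \o A_inv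
  = (if a == 0%N then 1 else 2) \*: Ct11 lam nu.
Proof.
apply/funext => w.
change (iota_form (in_1 (D1 lam nu (A_inv w)) - in_m1 (Dm1 lam nu (A_inv w)))
  = (if a == 0%N then 1 else 2) *: Ct11 lam nu w).
have F1 : A_inv w u1 = 2^-1 *: (w x1 + 'i%C *: w x2) by rewrite A_invE ffunE.
have F2 : A_inv w u2 = - w x3 by rewrite A_invE ffunE.
have F3 : A_inv w u3 = 2^-1 *: (- w x1 + 'i%C *: w x2) by rewrite A_invE ffunE.
have L0 : lshift 1 (0 : 'I_2) = x1 by exact/val_inj.
have L1 : lshift 1 (1 : 'I_2) = x2 by exact/val_inj.
have cinf_eq n (f g : Cinf R n) : (forall y, f y = g y) -> f = g.
  by move=> fg; exact/val_inj/funext.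
have ord2 (j : 'I_2) : j = 0 \/ j = 1.
  by case: j => [[|[|//]] ?]; [left | right]; exact/val_inj.
apply/ffunP => j; rewrite [RHS]ffunE.
case: a ha => [|a] ha.
  (* In order zero the coefficients are [F1 - F3] and [-i (F1 + F3)], which are those of the
     restricted form since [i^2 = -1]. *)
  have ii : 'i%C * 'i%C = -1 :> R[i] by rewrite -expr2 sqr_i.
  have -> : D1 lam nu (A_inv w) = Rest (A_inv w u1) by rewrite /D1 (natdiffE ha).
  have -> : Dm1 lam nu (A_inv w) = Rest (A_inv w u3) by rewrite /Dm1 (natdiffE ha).
  have -> : Ct11 lam nu w j = Rest (w (lshift 1 j)) by rewrite /Ct11 (natdiffE ha) ffunE.
  rewrite F1 F3 scale1r; case: (ord2 j) => ->; rewrite ?L0 ?L1 ?iota_form_diff0 ?iota_form_diff1;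
    apply: cinf_eq => y.
  - change (2^-1 * (w x1 (emb y) + 'i%C * w x2 (emb y))
      - 2^-1 * (- w x1 (emb y) + 'i%C * w x2 (emb y)) = w x1 (emb y)).
    by field.
  - change (- ('i%C * (2^-1 * (w x1 (emb y) + 'i%C * w x2 (emb y))
      + 2^-1 * (- w x1 (emb y) + 'i%C * w x2 (emb y)))) = w x2 (emb y)).
    transitivity (- ('i%C * 'i%C) * w x2 (emb y)); first by field.
    by rewrite ii opprK mul1r.
(* Minus [mlaplace] is the sum of the two second derivatives, which commute with the Gegenbauer
   operators. *)
have C2 f : (lam + (a./2)%:R) *: gegenbauer_op (lam + 1) (nu + 1) f
    + (gegenbauer_op (lam + 1) (nu - 1) (partial x1 (partial x1 f))
       + gegenbauer_op (lam + 1) (nu - 1) (partial x2 (partial x2 f)))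
    = (lam + a%:R) *: gegenbauer_op lam nu f.
  have G := gegenbauer_op_partial (lam + 1) (nu - 1).
  rewrite (G x1 (partial x1 f)) (G x1 f) (G x2 (partial x2 f)) (G x2 f).
  rewrite -(gegenbauer_op_contiguous2 f ha); congr (_ + _).
  by rewrite /mlaplace -opprD opprK.
have C1 f : gam (lam - 1) a.+1 *: gegenbauer_op (lam + 1) nu f
    = gegenbauer_op (lam + 1) (nu - 1) (partial x3 f)
      + gam (lam - 3 / 2) a.+1 *: gegenbauer_op lam (nu - 1) f.
  by rewrite (gegenbauer_op_partial _ _ x3) (gegenbauer_op_contiguous1 f ha).
(* Evaluation at [emb y] plays the role of [ev]; its linearity holds by conversion. *)
have symb y := @symbol_identity R (Cinf R 3) (partial x1) (partial x2) (partial x3)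
  (gegenbauer_op (lam + 1) (nu + 1)) (gegenbauer_op (lam + 1) nu)
  (gegenbauer_op (lam + 1) (nu - 1)) (gegenbauer_op lam nu) (gegenbauer_op lam (nu - 1))
  (fun f => f (emb y)) (lam + (a./2)%:R) (gam (lam - 1) a.+1) (gam (lam - 3 / 2) a.+1)
  (lam + a%:R) (w x1) (w x2) (w x3)
  (partial_is_linear x1) (partial_is_linear x2) (partial_is_linear x3)
  (gegenbauer_op_is_linear _ _) (gegenbauer_op_is_linear _ _) (gegenbauer_op_is_linear _ _)
  (gegenbauer_op_is_linear _ _) (gegenbauer_op_is_linear _ _)
  (fun c f g => erefl)
  (partial_comm x2 x1) (partial_comm x3 x1) (partial_comm x3 x2).
have evalB (f g : Cinf R 3) y : (Rest f - Rest g) y = (f - g) (emb y) by [].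
have evalND c (f g : Cinf R 3) y : (- (c *: (Rest f + Rest g))) y = - (c * (f + g) (emb y)) by [].
have evalZ c (f : Cinf R 3) y : (c *: Rest f) y = c * f (emb y) by [].
rewrite (D1E _ ha) (Dm1E _ ha) (Ct11E _ _ ha) F1 F2 F3 codiff3 /dz /dzbar.
case: (ord2 j) => ->; rewrite ?L0 ?L1 ?iota_form_diff0 ?iota_form_diff1; apply: cinf_eq => y.
- rewrite evalB evalZ; have [S _] := symb y C2 C1; cbv beta zeta in S.
  exact: S.
- rewrite evalND evalZ; have [_ S] := symb y C2 C1; cbv beta zeta in S.
  exact: S.
Qed.
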